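(* Let $k\geq r\geq2$, and let $G$ be a $k$-partite $r$-graph of order $n$ with partition sets $V_1,\ldots,V_k$ (so every edge of $G$ contains at most one vertex of each $V_j$). Then \[ \lambda^{(1)}(G)\leq r!\binom{k}{r}k^{-r}. \] (I) If $[x_i]$ is a positive $n$-vector such that $x_1+\cdots+x_n=1$ and \[ \lambda^{(1)}(G)=P_G([x_i])=r!\binom{k}{r}k^{-r}, \] then $G$ is complete $k$-partite and $\sum_{i\in V_j}x_i=\frac1k$ for $j=1,\ldots,k$. (II) If $G$ is complete $k$-partite (with respect to the partition $V_1,\ldots,V_k$) and $[x_i]$ is a nonnegative $n$-vector satisfying $\sum_{i\in V_j}x_i=\frac1k$ for $j=1,\ldots,k$, then $\lambda^{(1)}(G)=P_G([x_i])=r!\binom{k}{r}k^{-r}$.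
   Context: An $r$-graph of order $n$ is an $r$-uniform hypergraph with vertex set $[n]=\{1,\ldots,n\}$. Its polynomial form is $P_G([x_i])=r!\sum_{\{i_1,\ldots,i_r\}\in E(G)}x_{i_1}\cdots x_{i_r}$ for $[x_i]\in\mathbb{R}^n$, and for real $p\geq1$ its $p$-spectral radius is $\lambda^{(p)}(G)=\max_{|x_1|^p+\cdots+|x_n|^p=1}P_G([x_i])$. For $k\geq r\geq 2$, an $r$-graph is $k$-partite if its vertex set can be partitioned into $k$ sets so that each edge contains at most one vertex from each set; an edge-maximal $k$-partite $r$-graph is called complete $k$-partite (i.e., its edges are all $r$-sets meeting each partition set in at most one vertex). *)

(* Defs.v *)
From mathcomp Require Export all_boot all_order all_algebra.
From mathcomp Require Export all_classical all_reals all_analysis.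

Set Implicit Arguments.
Unset Strict Implicit.
Unset Printing Implicit Defensive.

Export Order.TTheory GRing.Theory Num.Theory.
Export numFieldNormedType.Exports.

Local Open Scope ring_scope.

(* The vertex set [n] is 'I_n. *)
Record rgraph (r n : nat) := RGraph {
  edges : {set {set 'I_n}};
  edges_uniform : forall e : {set 'I_n}, e \in edges -> #|e| = r }.

(* The partition sets are allowed to be empty. *)
Definition is_partition (n k : nat) (V : 'I_k -> {set 'I_n}) : Prop :=
  (forall i j, i != j -> [disjoint V i & V j]) /\
  (forall v, exists j, v \in V j).

Definition kpartite (r n k : nat) (G : rgraph r n)
    (V : 'I_k -> {set 'I_n}) : Prop :=
  forall e, e \in edges G -> forall j, (#|e :&: V j| <= 1)%N.

Definition complete_kpartite (r n k : nat) (G : rgraph r n)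
    (V : 'I_k -> {set 'I_n}) : Prop :=
  forall e : {set 'I_n},
    e \in edges G <-> #|e| = r /\ forall j, (#|e :&: V j| <= 1)%N.

Lemma complete_kpartiteP (r n k : nat) (G : rgraph r n)
    (V : 'I_k -> {set 'I_n}) :
  complete_kpartite G V <->
  kpartite G V /\
  forall H : rgraph r n, kpartite H V ->
    edges G \subset edges H -> edges H = edges G.
Proof.
split=> [cG|[kG maxG] e].
  split=> [e /cG[] // | H kH GH]; apply/eqP; rewrite finset.eqEsubset GH andbT.
  apply/fintype.subsetP => e eH; apply/cG; split; last exact: kH.
  exact: edges_uniform eH.
split=> [eG|[er eV]]; first by split; [exact: edges_uniform eG|exact: kG].
have U (f : {set 'I_n}) : f \in (e |: edges G)%SET -> #|f| = r.
  by rewrite !inE => /orP[/eqP->//|]; exact: edges_uniform.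
rewrite -(maxG (RGraph U)) /= ?setU11 ?finset.subsetUr//.
by move=> f; rewrite !inE => /orP[/eqP->//|]; exact: kG.
Qed.

Local Open Scope classical_set_scope.

Definition polyform (R : realType) (r n : nat) (G : rgraph r n)
    (x : 'rV[R]_n) : R :=
  r`!%:R * \sum_(e in edges G) \prod_(i in e) x ord0 i.

Definition psphere (R : realType) (n : nat) (p : R) : set 'rV[R]_n :=
  [set x | \sum_i `|x ord0 i| `^ p = 1].

(* For 1 <= p and 0 < n this supremum is a maximum: see spectral_radius_max.
   For n = 0 the sphere is empty and the value is sup set0 = 0. *)
Definition spectral_radius (R : realType) (r n : nat) (p : R)
    (G : rgraph r n) : R :=
  sup [set polyform G x | x in @psphere R n p].

Lemma continuous_norm_powR (R : realType) (p : R) : 0 < p ->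
  continuous (fun a : R => `|a| `^ p).
Proof.
move=> p0 a; have [->|a0] := eqVneq a 0.
  rewrite /continuous_at normr0 powR0 ?gt_eqF//.
  apply/cvgr0Pnorm_lt => e e0.
  near=> b; rewrite ger0_norm ?powR_ge0//.
  have -> : e = (e `^ p^-1) `^ p.
    by rewrite -powRrM mulVf ?gt_eqF// powRr1// ltW.
  rewrite gt0_ltr_powR ?nnegrE ?powR_ge0//.
  near: b; apply: (@cvgr0_norm_lt _ _ _ _ _ id); first exact: cvg_id.
  by rewrite powR_gt0.
apply: (@continuous_comp _ _ _ (fun a : R => `|a|) (fun b => b `^ p)).
  exact: norm_continuous.
apply: differentiable_continuous; apply/derivable1_diffP.
by apply: derivable_powR; rewrite in_itv/= andbT normr_gt0.
Unshelve. all: by end_near. Qed.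

Lemma psphere_compact (R : realType) (n : nat) (p : R) : 1 <= p ->
  compact (@psphere R n p).
Proof.
move=> p1; have p0 : 0 < p by exact: lt_le_trans p1.
apply: bounded_closed_compact.
  exists 1; split=> [|M M1 x /= xS]; first exact: real1.
  apply: le_trans (ltW M1).
  have -> : `|x| = mx_norm x by [].
  rewrite mx_normrE; apply: bigmax_le => // -[i j] _ /=.
  rewrite (ord1 i) -(ger0_norm (normr_ge0 _)) leNgt; apply/negP.
  rewrite normr_id => xj.
  have : 1 < `|x ord0 j| `^ p by exact: lt_le_trans (le1r_powR (ltW xj) p1).
  rewrite -xS (bigD1 j)//= ltNge lerDl sumr_ge0// => l _; exact: powR_ge0.
have -> : @psphere R n p =
    (fun x : 'rV[R]_n => \sum_i `|x ord0 i| `^ p) @^-1` [set 1] by [].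
apply: preimage_closed => [x _|]; last exact: closed_eq.
apply: continuous_big; first exact: add_continuous.
move=> i _ y; apply: (@continuous_comp _ _ _ (fun x : 'rV[R]_n => x ord0 i)
  (fun a : R => `|a| `^ p)).
  exact: coord_continuous.
exact: continuous_norm_powR.
Qed.

Lemma continuous_polyform (R : realType) (r n : nat) (G : rgraph r n) :
  continuous (@polyform R r n G).
Proof.
have cS : continuous (fun x : 'rV[R]_n =>
    \sum_(e in edges G) \prod_(i in e) x ord0 i).
  apply: continuous_big => [|e _]; first exact: add_continuous.
  apply: continuous_big => [|i _]; first exact: mul_continuous.
  exact: coord_continuous.
by move=> x; exact: (cvgM (cvg_cst _) (cS x)).
Qed.

Lemma spectral_radius_max (R : realType) (r n : nat) (p : R)
    (G : rgraph r n) : (0 < n)%N -> 1 <= p ->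
  (exists2 x, psphere p x & polyform G x = spectral_radius p G) /\
  (forall x, psphere p x -> polyform G x <= spectral_radius p G).
Proof.
case: n G => // n G _ p1; have p0 : p != 0 by rewrite gt_eqF// (lt_le_trans _ p1).
have S0 : @psphere R n.+1 p !=set0.
  exists (delta_mx ord0 ord0) => /=.
  rewrite /psphere/= (bigD1 ord0)//= big1 => [|i i0]; rewrite mxE ?eqxx/=.
    by rewrite normr1 powR1 addr0.
  by rewrite (negPf i0) normr0 powR0.
have [|c cS cmax] := EVT_max_rV S0 (psphere_compact p1) (f := polyform G).
  exact/continuous_subspaceT/continuous_polyform.
have maxE : spectral_radius p G = polyform G c.
  apply/eqP; rewrite eq_le; apply/andP; split.
    apply: ge_sup => [|_ [x xS <-]]; first exact: image_nonempty.
    by apply: cmax; rewrite inE.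
  apply: ub_le_sup; last by exists c => //; rewrite inE in cS.
  by exists (polyform G c) => _ [x xS <-]; apply: cmax; rewrite inE.
split; first by exists c => //; rewrite inE in cS.
by move=> x xS; rewrite maxE; apply: cmax; rewrite inE.
Qed.

(* Main.v *)
(* Adding the missing transversal edges only increases [polyform] on
   nonnegative vectors, and for the complete [k]-partite graph [polyform] is
   [r!] times the [r]-th elementary symmetric polynomial of the class sums
   [y_j]. Maclaurin's inequality bounds it: the elementary symmetric means
   satisfy [p_(q+1) <= p_q p_1], and for [q = 1] this is Cauchy-Schwarz, with
   equality only for equal [y_j]. Since [r >= 2], the step [q = 1] always
   occurs in the chain, so equality forces all [y_j] to be [1/k]; if moreover
   [x] is positive, a missing edge would cost a positive amount. *)

Require Import Defs.
From mathcomp Require Import ring lra zify.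

Set Implicit Arguments.
Unset Strict Implicit.
Unset Printing Implicit Defensive.

Local Open Scope ring_scope.

(** * Elementary symmetric polynomials and Maclaurin's inequality *)

Section OrderedElementarySymmetric.
Variables (R : realFieldType) (J : finType) (y : J -> R).
Implicit Type A : {set J}.

(* [r`!] times the elementary symmetric polynomial of degree [r] in the
   variables indexed by [A], i.e. the sum over ordered [r]-tuples of distinct
   indices. *)
Fixpoint ordered_esym (r : nat) (A : {set J}) : R :=
  if r is q.+1 then \sum_(j in A) y j * ordered_esym q (A :\ j)%SET else 1.

Local Notation F := ordered_esym.

Lemma ordered_esymS r A :
  F r.+1 A = \sum_(j in A) y j * F r (A :\ j)%SET.
Proof. by []. Qed.

Local Arguments ordered_esym : simpl never.

Lemma ordered_esym1 A : F 1 A = \sum_(j in A) y j.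
Proof. by rewrite ordered_esymS; apply: eq_bigr => j _; rewrite mulr1. Qed.

(** An ordered tuple of distinct indices either avoids [j] or has it at exactly one of its [r.+1]
    positions. *)
Lemma ordered_esymD1 r A j : j \in A ->
  F r.+1 A = F r.+1 (A :\ j)%SET + r.+1%:R * y j * F r (A :\ j)%SET.
Proof.
elim: r A => [|r IH] A jA.
  by rewrite !ordered_esym1 (big_setD1 j)//= addrC mul1r mulr1.
rewrite ordered_esymS (big_setD1 j)//=.
rewrite (eq_bigr (fun i => y i * F r.+1 (A :\ j :\ i)%SET +
    r.+1%:R * y j * (y i * F r (A :\ j :\ i)%SET))); last first.
  move=> i; rewrite !inE => /andP[ij iA].
  have jAi : j \in (A :\ i)%SET by rewrite !inE eq_sym ij.
  have -> : (A :\ j :\ i = A :\ i :\ j)%SET.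
    by apply/setP => l; rewrite !inE andbCA.
  by rewrite (IH _ jAi); ring.
rewrite big_split -mulr_sumr /= -!ordered_esymS.
by rewrite -[r.+2%:R]natr1; ring.
Qed.

(** An index put in front of an [r.+1]-tuple is either new or repeats one of the [r.+1] entries,
    which produces the squares. *)
Lemma sum_mul_ordered_esym r A :
  (\sum_(j in A) y j) * F r.+1 A =
  F r.+2 A + r.+1%:R * \sum_(j in A) y j ^+ 2 * F r (A :\ j)%SET.
Proof.
rewrite mulr_suml mulr_sumr [F r.+2 A]ordered_esymS.
by rewrite -big_split; apply: eq_bigr => j jA; rewrite (ordered_esymD1 _ jA) /=; ring.
Qed.

Lemma ordered_esym_const a r A : {in A, forall j, y j = a} ->
  F r A = (#|A| ^_ r)%:R * a ^+ r.
Proof.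
elim: r A => [|r IH] A yA; first by rewrite ffactn0 mul1r.
rewrite ordered_esymS (eq_bigr (fun=> a * ((#|A|.-1 ^_ r)%:R * a ^+ r))).
  by rewrite sumr_const ffactnS natrM exprS -[LHS]mulr_natl; ring.
move=> j jA; rewrite yA// IH => [|i]; last by rewrite !inE => /andP[_ /yA].
by rewrite (cardsD1 j A) jA.
Qed.

Lemma ordered_esym2 A :
  F 2 A = (\sum_(j in A) y j) ^+ 2 - \sum_(j in A) y j ^+ 2.
Proof.
have := sum_mul_ordered_esym 0 A; rewrite ordered_esym1 mul1r.
by under [X in _ = _ + X]eq_bigr do rewrite mulr1; rewrite expr2 => ->; ring.
Qed.

(** This variance identity yields both Cauchy-Schwarz and its equality case. *)
Lemma sum_sqr_dev A (s := \sum_(j in A) y j) :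
  \sum_(j in A) (#|A|%:R * y j - s) ^+ 2 =
  #|A|%:R * (#|A|%:R * \sum_(j in A) y j ^+ 2 - s ^+ 2).
Proof.
rewrite (eq_bigr (fun j => #|A|%:R ^+ 2 * y j ^+ 2 +
  (- 2 * #|A|%:R * s) * y j + s ^+ 2)) => [|j _]; last by ring.
rewrite !big_split /= sumr_const -!mulr_sumr -/s -[s ^+ 2 *+ _]mulr_natr.
by ring.
Qed.

Lemma sqr_sum_le A :
  (\sum_(j in A) y j) ^+ 2 <= #|A|%:R * \sum_(j in A) y j ^+ 2.
Proof.
have [A0|A0] := posnP #|A|.
  by rewrite A0 mul0r (cards0_eq A0) big_set0 expr2 mulr0.
have A1 : 0 < #|A|%:R :> R by rewrite ltr0n.
rewrite -subr_ge0 -(pmulr_rge0 _ A1) -sum_sqr_dev.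
by apply: sumr_ge0 => j _; exact: sqr_ge0.
Qed.

(* With [p_r] the [r]-th elementary symmetric mean of [y] on [A], this says
   [p_(r+1) <= p_r * p_1]. *)
Lemma ordered_esym_step r A : (forall j, 0 <= y j) -> (r <= #|A|)%N ->
  #|A|%:R * F r.+1 A <= (#|A|%:R - r%:R) * (\sum_(j in A) y j) * F r A.
Proof.
move=> y0; elim: r A => [|[|r] IH] A rA.
- by rewrite ordered_esym1 subr0 mulr1.
(* Degree 1 is a separate base case: in the inductive argument below, the factor to be cancelled
   would be 0 here. *)
- by rewrite ordered_esym1 ordered_esym2; have := sqr_sum_le A; lra.
set s := \sum_(j in A) y j.
(* The induction hypothesis on each [A :\ j], weighted by [y j] and summed over [j]. *)
have IHs : (#|A|%:R - 1) * F r.+3 A <= (#|A|%:R - r.+2%:R) *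
    (s * F r.+2 A - \sum_(j in A) y j ^+ 2 * F r.+1 (A :\ j)%SET).
  rewrite [F r.+3 A]ordered_esymS [F r.+2 A]ordered_esymS.
  rewrite !mulr_sumr -sumrB mulr_sumr; apply: ler_sum => j jA.
  have cA : #|A| = #|(A :\ j)%SET|.+1 by rewrite (cardsD1 j) jA.
  have := IH (A :\ j)%SET; rewrite -ltnS -cA => /(_ rA).
  have -> : \sum_(i in (A :\ j)%SET) y i = s - y j.
    by rewrite /s (big_setD1 j jA) /= addrC addrK.
  move=> /(ler_wpM2l (y0 j)); rewrite cA -[_.+1%:R]natr1 -[r.+2%:R]natr1.
  by lra.
(* Eliminating [Q] brings [F r.+3 A] to the right as well; once collected, both sides carry the
   common factor [r.+1]. *)
have := sum_mul_ordered_esym r.+1 A; rewrite -/s.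
set Q := \sum_(j in A) _ in IHs * => sE.
have {}IHs := ler_wpM2l (ler0n R r.+2) IHs.
have r1 : 0 < r.+1%:R :> R by rewrite ltr0n.
rewrite -(ler_pM2l r1).
move: IHs.
have -> : r.+2%:R * ((#|A|%:R - r.+2%:R) * (s * F r.+2 A - Q)) =
  (#|A|%:R - r.+2%:R) * (r.+2%:R * (s * F r.+2 A) - r.+2%:R * Q) by ring.
have -> : r.+2%:R * Q = s * F r.+2 A - F r.+3 A by rewrite sE; ring.
have -> : r.+2%:R = r.+1%:R + 1 :> R by rewrite natr1.
by lra.
Qed.

(** The chain of steps stops at degree 2, so that the last step, Cauchy-Schwarz, stays available for
    the equality case. *)
Lemma ordered_esym_le2 q A : (forall j, 0 <= y j) -> (q.+2 <= #|A|)%N ->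
  \sum_(j in A) y j = 1 ->
  #|A|%:R ^+ q * F q.+2 A <= ((#|A| - 2) ^_ q)%:R * F 2 A.
Proof.
move=> y0 + s1; elim: q => [|q IH] qA; first by rewrite expr0 ffactn0.
have := ordered_esym_step y0 (ltnW qA); rewrite s1 mulr1 => st.
have m0 : 0 <= #|A|%:R ^+ q :> R by rewrite exprn_ge0.
rewrite exprSr -mulrA; apply: (le_trans (ler_wpM2l m0 st)).
rewrite -natrB ?(ltnW qA)// mulrCA.
apply: (le_trans (ler_wpM2l (ler0n _ _) (IH (ltnW qA)))).
by rewrite mulrA -natrM ffactnSr mulnC -subnDA.
Qed.

Lemma ffact_split2 m q : (2 <= m)%N ->
  (m ^_ q.+2 = m * m.-1 * (m - 2) ^_ q)%N.
Proof. by case: m => [|[|m]]// _; rewrite !ffactSS /= subn2 /= mulnA. Qed.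

Lemma maclaurin q A : (forall j, 0 <= y j) -> (q.+2 <= #|A|)%N ->
  \sum_(j in A) y j = 1 ->
  F q.+2 A <= (#|A| ^_ q.+2)%:R * #|A|%:R ^- q.+2.
Proof.
move=> y0 qA s1; have m2 : (2 <= #|A|)%N by apply: leq_trans qA.
have m0 : 0 < #|A|%:R :> R by rewrite ltr0n (leq_trans _ m2).
rewrite ler_pdivlMr ?exprn_gt0// ffact_split2// mulrC -addn2 exprD mulrAC -mulrA.
apply: le_trans; first by rewrite mulrA; apply: ler_wpM2r;
  [exact: sqr_ge0 | rewrite addn2; exact: ordered_esym_le2].
have := sqr_sum_le A; rewrite s1 expr1n ordered_esym2 s1 expr1n => c.
rewrite natrM [leRHS]mulrC -mulrA; apply: ler_wpM2l; first exact: ler0n.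
rewrite natrM -subn1 natrB ?(ltnW m2)//.
by have := ler_wpM2l (ltW m0) c; lra.
Qed.

Lemma maclaurin_eq q A : (forall j, 0 <= y j) -> (q.+2 <= #|A|)%N ->
  \sum_(j in A) y j = 1 ->
  F q.+2 A = (#|A| ^_ q.+2)%:R * #|A|%:R ^- q.+2 ->
  {in A, forall j, y j = #|A|%:R^-1}.
Proof.
move=> y0 qA s1 Feq j jA; have m2 : (2 <= #|A|)%N by apply: leq_trans qA.
have m0 : 0 < #|A|%:R :> R by rewrite ltr0n (leq_trans _ m2).
have f0 : 0 < ((#|A| - 2) ^_ q)%:R :> R.
  by rewrite ltr0n ffact_gt0; lia.
have := ordered_esym_le2 y0 qA s1; rewrite Feq ffact_split2// => /(ler_wpM2r (sqr_ge0 #|A|%:R)).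
have -> : #|A|%:R ^+ q * ((#|A| * #|A|.-1 * (#|A| - 2) ^_ q)%:R * #|A|%:R ^- q.+2) *
    #|A|%:R ^+ 2 = ((#|A| - 2) ^_ q)%:R * (#|A|%:R * (#|A|%:R - 1)) :> R.
  rewrite !natrM -subn1 natrB ?(ltnW m2)// 2!exprS.
  by field; rewrite expf_neq0 gt_eqF ?m0.
(* Cancelling the positive factors leaves the reverse of Cauchy-Schwarz, so all deviations from the
   mean vanish. *)
rewrite -mulrA ler_pM2l// ordered_esym2 s1 expr1n expr2 mulrCA ler_pM2l// => le2.
have dev0 : \sum_(i in A) (#|A|%:R * y i - 1) ^+ 2 = 0.
  have := sum_sqr_dev A; rewrite /= s1 expr1n => devE.
  apply/eqP; rewrite eq_le sumr_ge0 => [|i _]; last exact: sqr_ge0.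
  by rewrite andbT devE pmulr_rle0//; lra.
move/eqP: dev0; rewrite psumr_eq0 => [|i _]; last exact: sqr_ge0.
move=> /allP/(_ j (mem_index_enum _)); rewrite jA /= sqrf_eq0 subr_eq0 => /eqP yj.
by apply: (mulfI (lt0r_neq0 m0)); rewrite yj divff ?lt0r_neq0.
Qed.

End OrderedElementarySymmetric.

(** * Sums over transversal sets, with classes seen as colours *)

Section RainbowSets.
Variables (R : realFieldType) (I J : finType) (c : I -> J).
Implicit Types (A : {set J}) (e : {set I}).

(** The palette [A] is a parameter so that a recursion can remove the colours already used. *)
Definition rainbow (r : nat) A e : bool :=
  [&& #|e| == r, (c @: e)%SET \subset A & #|(c @: e)%SET| == #|e|].

Lemma rainbowU1 r A v e : v \notin e ->
  rainbow r.+1 A (v |: e)%SET = (c v \in A) && rainbow r (A :\ c v)%SET e.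
Proof.
move=> ve; rewrite /rainbow imsetU1 !cardsU1 ve finset.subUset finset.sub1set finset.subsetD1 eqSS.
have := leq_imset_card c (mem e).
case: (c v \in A) => //=; last by rewrite andbF.
case: (c v \in (c @: e)%SET) => /=; last by rewrite eqSS andbT.
(* If the colour of [v] already occurs in [e], the left side would need [#|e|.+1] colours from [e]
   alone. *)
rewrite andbF add0n add1n; case: eqP => //= _ le; case: (_ \subset _) => //=.
by apply/negbTE; rewrite neq_ltn ltnS le.
Qed.

(* Both sides satisfy the recursion that removes one vertex of an ordered
   rainbow set together with its colour class. *)
Lemma sum_rainbow (x : I -> R) r A :
  r`!%:R * \sum_(e | rainbow r A e) \prod_(i in e) x i =
  ordered_esym (fun j => \sum_(i | c i == j) x i) r A.
Proof.
elim: r A => [|r IH] A.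
  rewrite fact0 mul1r (big_pred1 finset.set0) ?big_set0// => e.
  rewrite /rainbow cards_eq0 /=; case: (eqVneq e finset.set0) => //= ->.
  by rewrite imset0 finset.sub0set !cards0.
rewrite factS natrM mulrAC mulr_sumr ordered_esymS.
under [RHS]eq_bigr do rewrite -IH.
(* The factor [r.+1] counts the choices of a first vertex [v] in [e]. *)
have -> : \sum_(e | rainbow r.+1 A e) r.+1%:R * \prod_(i in e) x i =
    \sum_(e | rainbow r.+1 A e) \sum_(v in e) x v * \prod_(i in (e :\ v)%SET) x i.
  apply: eq_bigr => e /and3P[/eqP er _ _].
  rewrite [RHS](eq_bigr (fun=> \prod_(i in e) x i)) => [|v ve].
    by rewrite sumr_const er mulr_natl.
  by rewrite [RHS](big_setD1 v ve).
rewrite (exchange_big_dep predT) //=.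
rewrite (eq_bigr (fun v => x v * \sum_(e | (c v \in A) && rainbow r (A :\ c v)%SET e)
   \prod_(i in e) x i)) => [|v _]; last first.
  rewrite mulr_sumr (reindex_onto (fun e => v |: e)%SET (fun e => e :\ v)%SET) /=.
    apply: eq_big => e.
      (* For [v] in [e] both conditions fail: deleting [v] does not give back [e], and the colour of
         [v] is no longer in the palette. *)
      rewrite setU11 andbT; have [ve|ve] := boolP (v \in e).
        rewrite [RHS](_ : _ = false).
          apply/negbTE; rewrite negb_and; apply/orP; right.
          by apply/eqP => /setP/(_ v); rewrite !inE eqxx ve.
        apply/negbTE/negP => /and4P[_ _ /fintype.subsetP/(_ (c v)) + _].
        by rewrite !inE eqxx imset_f// => /(_ isT).
      by rewrite rainbowU1// setU1K// eqxx andbT.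
    by move=> /andP[_ /eqP ->].
  by move=> e /andP[_ ve]; rewrite finset.setD1K.
rewrite mulr_suml (partition_big c predT) //= [RHS]big_mkcond /=.
apply: eq_bigr => j _; case: ifP => jA.
  rewrite mulr_suml; apply: eq_bigr => v /eqP ->; rewrite jA /=.
  by ring.
by rewrite big1// => v /eqP ->; rewrite jA /= big_pred0// mulr0 mul0r.
Qed.

End RainbowSets.

(** * Colourings from partitions, and the theorem *)

Lemma partition_color (k n : nat) (V : 'I_k -> {set 'I_n}) :
  is_partition V -> exists c : 'I_n -> 'I_k, forall v j, (v \in V j) = (c v == j).
Proof.
move=> [disjV /choice[c cV]]; exists c => v j; apply/idP/eqP => [vj|<-//].
apply/eqP/negPn/negP => /disjV/pred0P/(_ v) /=.
by rewrite cV vj.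
Qed.

Lemma rainbow_transversal (k n r : nat) (V : 'I_k -> {set 'I_n})
    (c : 'I_n -> 'I_k) (e : {set 'I_n}) :
  (forall v j, (v \in V j) = (c v == j)) ->
  rainbow c r finset.setT e <-> #|e| = r /\ forall j, (#|e :&: V j|%SET <= 1)%N.
Proof.
move=> cV; rewrite /rainbow finset.subsetT /=; split.
  move=> /andP[/eqP er /imset_injP cinj]; split=> // j.
  apply/card_le1P => u; rewrite !inE cV => /andP[ue /eqP uj] v.
  rewrite !inE cV; apply/andP/eqP => [[ve /eqP vj]|->]; last by rewrite ue uj.
  by apply: cinj; rewrite ?uj.
move=> [/eqP -> ej] /=; apply/imset_injP => u v ue ve cuv.
have /card_le1_eqP := ej (c u); by apply; rewrite !inE cV ?ue ?ve ?cuv eqxx.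
Qed.

Theorem theorem1 (R : realType) (r k n : nat) (hr : (2 <= r)%N)
    (hk : (r <= k)%N) (G : rgraph r n) (V : 'I_k -> {set 'I_n})
    (hV : is_partition V) (hG : kpartite G V) :
  spectral_radius (1 : R) G <= r`!%:R * 'C(k, r)%:R * k%:R ^- r /\
  (forall x : 'rV[R]_n,
     (forall i, 0 < x ord0 i) ->
     \sum_i x ord0 i = 1 ->
     spectral_radius (1 : R) G = polyform G x ->
     polyform G x = r`!%:R * 'C(k, r)%:R * k%:R ^- r ->
     complete_kpartite G V /\
     forall j, \sum_(i in V j) x ord0 i = k%:R^-1) /\
  (complete_kpartite G V ->
   forall x : 'rV[R]_n,
     (forall i, 0 <= x ord0 i) ->
     (forall j, \sum_(i in V j) x ord0 i = k%:R^-1) ->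
     spectral_radius (1 : R) G = polyform G x /\
     polyform G x = r`!%:R * 'C(k, r)%:R * k%:R ^- r).
Proof.
have [c cV] := partition_color hV.
have k0 : k%:R != 0 :> R by rewrite pnatr_eq0; lia.
have rf0 : 0 < r`!%:R :> R by rewrite ltr0n fact_gt0.
pose bound : R := r`!%:R * 'C(k, r)%:R * k%:R ^- r.
have boundE : bound = (k ^_ r)%:R * k%:R ^- r.
  by rewrite /bound -natrM mulnC bin_ffact.
pose y (z : 'I_n -> R) j := \sum_(i | c i == j) z i.
have yE z j : \sum_(i in V j) z i = y z j by apply: eq_bigl => i; rewrite cV.
have sum_y z : \sum_(j in [set: 'I_k]%SET) y z j = \sum_i z i.
  rewrite [RHS](partition_big c predT)//=; apply: eq_bigl => j; by rewrite inE.
(* The polynomial form of the complete [k]-partite graph on the classes [V]. *)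
pose T (z : 'I_n -> R) :=
  r`!%:R * \sum_(e | rainbow c r finset.setT e) \prod_(i in e) z i.
have TE z : T z = ordered_esym (y z) r finset.setT by exact: sum_rainbow.
have y_ge0 z : (forall i, 0 <= z i) -> forall j, 0 <= y z j.
  by move=> z0 j; apply: sumr_ge0.
have [q rq] : exists q, r = q.+2 by exists r.-2; lia.
have qk : (q.+2 <= k)%N by rewrite -rq.
have cardT : #|[set: 'I_k]%SET| = k by rewrite cardsT card_ord.
have T_le z : (forall i, 0 <= z i) -> \sum_i z i = 1 -> T z <= bound.
  move=> z0 z1; rewrite TE boundE rq.
  by rewrite -[in leRHS]cardT; apply: maclaurin;
    rewrite ?cardT ?sum_y//; exact: y_ge0.
have T_eq z : (forall i, 0 <= z i) -> \sum_i z i = 1 -> T z = bound ->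
    forall j, y z j = k%:R^-1.
  move=> z0 z1; rewrite TE boundE rq => Teq j.
  rewrite -cardT; apply: (maclaurin_eq (q := q) (A := finset.setT));
    rewrite ?cardT ?sum_y//; exact: y_ge0.
have T_split z : T z = r`!%:R * (\sum_(e in edges G) \prod_(i in e) z i) +
   r`!%:R * \sum_(e | rainbow c r finset.setT e && (e \notin edges G))
     \prod_(i in e) z i.
  rewrite /T (bigID (mem (edges G))) /= mulrDr; congr (_ * _ + _).
  apply: eq_bigl => e; rewrite andb_idl// => eG.
  by apply/(rainbow_transversal _ _ cV); split; [exact: edges_uniform eG|exact: hG].
have G_le z : (forall i, 0 <= z i) ->
    r`!%:R * (\sum_(e in edges G) \prod_(i in e) z i) <= T z.
  move=> z0; rewrite T_split lerDl mulr_ge0// sumr_ge0// => e _.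
  exact: prodr_ge0.
have sphere_le (x : 'rV[R]_n) : psphere 1 x -> polyform G x <= bound.
  move=> x1; have s1 : \sum_i `|x ord0 i| = 1.
    by rewrite -[RHS]x1; apply: eq_bigr => i _; rewrite powRr1.
  (* Sphere vectors may have negative entries; absolute values only increase the form. *)
  apply: le_trans (T_le _ (fun i => normr_ge0 _) s1).
  apply: le_trans (G_le _ (fun i => normr_ge0 _)).
  rewrite /polyform ler_pM2l//; apply: ler_sum => e _.
  by rewrite -normr_prod ler_norm.
have sum1_gt0 (z : 'I_n -> R) : \sum_i z i = 1 -> (0 < n)%N.
  have [n0|//] := posnP n; rewrite big1 => [/eqP|i _].
    by rewrite eq_sym oner_eq0.
  by have := ltn_ord i; rewrite [X in (_ < X)%N]n0.
split; last split.
- have [n0|n0] := posnP n.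
    (* With no vertices the sphere is empty and the supremum defaults to 0. *)
    rewrite /spectral_radius (_ : [set _ | _ in _]%classic = set0) ?sup0.
      by rewrite -/bound boundE mulr_ge0// invr_ge0 exprn_ge0.
    by rewrite -subset0 => z [x /sum1_gt0 + _]; rewrite n0.
  by have [[x xS <-] _] := spectral_radius_max G n0 (lexx (1 : R)); exact: sphere_le.
- move=> x x0 x1 _; rewrite -/bound => Geq.
  have x0' i : 0 <= x ord0 i by exact: ltW.
  have TG : T (x ord0) = bound.
    by apply/le_anti; rewrite T_le//= -Geq; exact: G_le.
  split=> [e|j]; last by rewrite yE; exact: T_eq.
  split=> [eG|/(rainbow_transversal _ _ cV) eR].
    by split; [exact: edges_uniform eG|exact: hG].
  apply/negPn/negP => eG.
  (* The missing transversal sets contribute 0 in total, but the term of [e] is positive. *)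
  have := T_split (x ord0); rewrite TG -Geq -[LHS]addr0 => /addrI/esym/eqP.
  rewrite mulf_eq0 gt_eqF//= psumr_eq0 => [|f _]; last exact: prodr_ge0.
  move=> /allP/(_ e (mem_index_enum _)); rewrite eR eG /=.
  by rewrite gt_eqF// prodr_gt0.
- move=> Gc x x0 xV.
  have x1 : \sum_i x ord0 i = 1.
    rewrite -sum_y (eq_bigr (fun=> k%:R^-1)) => [|j _]; last by rewrite -yE.
    by rewrite sumr_const cardT -[LHS]mulr_natr mulVf.
  have n0 := sum1_gt0 _ x1.
  have GB : polyform G x = bound.
    rewrite boundE -exprVn -[in RHS]cardT -(ordered_esym_const (y := y (x ord0))).
      rewrite -TE /polyform /T; congr (_ * _); apply: eq_bigl => e.
      by apply/idP/idP => [/Gc|] /(rainbow_transversal _ _ cV)// /Gc.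
    by move=> j _; rewrite -yE cardT.
  split=> //.
  have xS : psphere 1 x.
    by rewrite /psphere/= -[RHS]x1; apply: eq_bigr => i _; rewrite powRr1// ger0_norm.
  have [[z zS zE] xmax] := spectral_radius_max G n0 (lexx (1 : R)).
  by apply/le_anti; rewrite xmax// -zE GB sphere_le.
Qed.
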